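(* Let $(\mathcal J,E)$ be a marked 2-category, let $\mathcal C$ be a 2-category, let $F\colon \mathcal J\to\mathcal C$ be a 2-functor, and let $(\ell,\lambda)$ be an $E$-lax cone over $F$. The following statements are equivalent: (1) $(\ell,\lambda)$ is an $E$-bilimit of $F$; (2) the projection 2-functor $\overline{\mathcal C_{/F^\triangleleft}}\to \mathcal C^{/F}_E$ (formed with respect to $(\ell,\lambda)$) is a biequivalence; (3) the object $(\ell,\lambda)$ of $\mathcal C^{/F}_E$ is limiting bifinal.
   Context: Conventions. 2-categories and 2-functors are strict. Composition of 1-cells and whiskering are written by juxtaposition; $\beta\circ\alpha$ is vertical composition of 2-cells (first $\alpha$, then $\beta$). $\mathcal C(x,y)$ is the hom-category. A marked 2-category $(\mathcal J,E)$ is a 2-category $\mathcal J$ with a class $E$ of 1-cells containing all identities. $E$-lax cones. An $E$-lax cone $(x,\alpha)$ over $F\colon\mathcal J\to\mathcal C$ is an object $x$ of $\mathcal C$, 1-cells $\alpha_i\colon x\to Fi$ for each object $i$ of $\mathcal J$, and 2-cells $\alpha_k\colon F(k)\alpha_i\to\alpha_j$ for each 1-cell $k\colon i\to j$ of $\mathcal J$, such that $\alpha_{1_i}=1_{\alpha_i}$; $\alpha_{hk}=\alpha_h\circ(F(h)\alpha_k)$ for composable $k,h$; $\alpha_k=\alpha_{k'}\circ(F(\Lambda)\alpha_i)$ for each 2-cell $\Lambda\colon k\to k'$ with $k,k'\colon i\to j$; and $\alpha_k$ is invertible for $k\in E$. For fixed $x$, these are the objects of a category $[\mathcal J,\mathcal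 C]_E(\Delta x,F)$ whose morphisms $\beta\to\alpha$ are the modifications: families of 2-cells $\mu_i\colon\beta_i\to\alpha_i$ with $\alpha_k\circ(F(k)\mu_i)=\mu_j\circ\beta_k$ for all $k\colon i\to j$. $E$-bilimit. An $E$-lax cone $(\ell,\lambda)$ is an $E$-bilimit of $F$ if for every object $x$ of $\mathcal C$ the functor $\mathcal C(x,\ell)\to[\mathcal J,\mathcal C]_E(\Delta x,F)$, $f\mapsto\lambda\cdot f$ (with components $\lambda_i f$ and $\lambda_k f$), $\zeta\mapsto\lambda\cdot\zeta=(\lambda_i\zeta)_i$, is an equivalence of categories. 2-category of cones $\mathcal C^{/F}_E$. Objects: $E$-lax cones $(x,\alpha)$ over $F$. 1-cells $(x,\alpha)\to(y,\beta)$: pairs $(f,\mu)$ with $f\colon x\to y$ and 2-cells $\mu_i\colon\beta_i f\to\alpha_i$ such that $\alpha_k\circ(F(k)\mu_i)=\mu_j\circ(\beta_k f)$ for all $k\colon i\to j$. 2-cells $(f,\mu)\to(g,\delta)$: 2-cells $\Xi\colon f\to g$ of $\mathcal C$ with $\delta_i\circ(\beta_i\Xi)=\mu_i$ for all $i$. Composition of 1-cells: $(g,\nu)(f,\mu)=(gf,\ (\mu_i\circ(\nu_i f))_i)$; the rest is inherited from $\mathcal C$. Let $p\colon\mathcal C^{/F}_E\to\mathcal C$ be the projection $(x,\alpha)\mapsto x$, $(f,\mu)\mapsto f$, $\Xi\mapsto\Xi$. Modified 2-category of cones $\overline{\mathcal C_{/F^\triangleleft}}$ (for a fixed $E$-lax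 cone $(\ell,\lambda)$). Objects: $(x,h,\alpha,\sigma)$ with $h\colon x\to\ell$ a 1-cell, $(x,\alpha)$ an $E$-lax cone over $F$, and invertible 2-cells $\sigma_i\colon\lambda_i h\to\alpha_i$ with $\alpha_k\circ(F(k)\sigma_i)=\sigma_j\circ(\lambda_k h)$ for $k\colon i\to j$. 1-cells $(x,h,\alpha,\sigma)\to(y,g,\beta,\tau)$: triples $(f,\zeta,\mu)$ with $(f,\mu)\colon(x,\alpha)\to(y,\beta)$ a 1-cell of $\mathcal C^{/F}_E$ and $\zeta\colon gf\to h$ a 2-cell of $\mathcal C$ with $\mu_i\circ(\tau_i f)=\sigma_i\circ(\lambda_i\zeta)$ for all $i$. 2-cells $(f,\zeta,\mu)\to(f',\zeta',\mu')$: 2-cells $\Xi\colon f\to f'$ with $\zeta'\circ(g\Xi)=\zeta$ and $\mu'_i\circ(\beta_i\Xi)=\mu_i$ for all $i$. Composition: $(f',\zeta',\mu')(f,\zeta,\mu)=(f'f,\ \zeta\circ(\zeta' f),\ (\mu_i\circ(\mu'_i f))_i)$. The projection to $\mathcal C^{/F}_E$ sends $(x,h,\alpha,\sigma)\mapsto(x,\alpha)$, $(f,\zeta,\mu)\mapsto(f,\mu)$, $\Xi\mapsto\Xi$. Biequivalence: a 2-functor that induces equivalences on all hom-categories and such that every object of the target is equivalent to one in the image. Cartesian 1-cells. For a 2-functor $p\colon\mathcal E\to\mathcal B$, a 1-cell $f\colon x\to y$ of $\mathcal E$ is $p$-cartesian if for every object $a$ the square with $f\circ-\colon\mathcal E(a,x)\to\mathcal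 E(a,y)$ over $p(f)\circ-\colon\mathcal B(pa,px)\to\mathcal B(pa,py)$ is a (strict) pullback of categories. Contractions. A contraction on a 2-category $\mathcal D$ with center $c$ consists of 1-cells $\gamma_x\colon x\to c$ for all objects $x$ and 2-cells $\gamma_f\colon\gamma_y f\to\gamma_x$ for all 1-cells $f\colon x\to y$, such that $\gamma_{1_x}=1_{\gamma_x}$; $\gamma_{gf}=\gamma_f\circ(\gamma_g f)$ for composable $f,g$; $\gamma_f=\gamma_g\circ(\gamma_y\alpha)$ for every 2-cell $\alpha\colon f\to g\colon x\to y$; $\gamma_c=1_c$; and $\gamma_{\gamma_x}=1_{\gamma_x}$ for all $x$. If $M$ is a marking of $\mathcal D$, an $M$-contraction is a contraction with every $\gamma_x$ in $M$ and $\gamma_f$ invertible for every $f\in M$. A limiting contraction on $\mathcal C^{/F}_E$ is an $M_{\mathrm{cart}}$-contraction, where $M_{\mathrm{cart}}$ is the class of $p$-cartesian 1-cells of $\mathcal C^{/F}_E$. An object $(\ell,\lambda)$ is limiting bifinal if it is the center of a limiting contraction on $\mathcal C^{/F}_E$. *)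

(* Defs.v *)
From Stdlib Require Import FunctionalExtensionality ProofIrrelevance.

Set Implicit Arguments.
Unset Strict Implicit.
Unset Printing Implicit Defensive.

Declare Scope twocat_scope.
Delimit Scope twocat_scope with twocat.
Local Open Scope twocat_scope.

Record Category := MkCategory {
  obj :> Type;
  mor : obj -> obj -> Type;
  idm : forall a, mor a a;
  comp : forall {a b c}, mor b c -> mor a b -> mor a c;
  comp_idl : forall a b (u : mor a b), comp (idm b) u = u;
  comp_idr : forall a b (u : mor a b), comp u (idm a) = u;
  comp_assoc : forall a b c d (w : mor c d) (v : mor b c) (u : mor a b),
    comp w (comp v u) = comp (comp w v) u
}.
Arguments mor {_} _ _.
Arguments idm {_} _.
Arguments comp {_ _ _ _} _ _.

Notation "v \o u" := (comp v u) (at level 50, left associativity) : twocat_scope.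

(** In a strict 2-category the two sides of an equation between 2-cells often
    have boundaries that are equal as 1-cells without being convertible, for
    instance [(h g) f] and [h (g f)].  [u === v] says that [u] and [v] have
    equal sources, equal targets, and are equal; when the boundaries are
    convertible it is ordinary equality ([heq_eq] below). *)
Inductive heq {A : Category} {a b : A} (u : mor a b) :
  forall {a' b' : A}, mor a' b' -> Prop :=
| heq_refl : heq u u.

Notation "u === v" := (heq u v) (at level 70, no associativity) : twocat_scope.

Definition idcast {A : Category} {a b : A} (e : a = b) : mor a b :=
  match e in _ = b' return mor a b' with eq_refl => idm a end.

Definition is_iso {A : Category} {a b : A} (u : mor a b) : Prop :=
  exists v : mor b a, v \o u = idm a /\ u \o v = idm b.

Record Functor (A B : Category) := MkFunctor {
  fob :> A -> B;
  fmap : forall {a a' : A}, mor a a' -> mor (fob a) (fob a');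
  fmap_id : forall a, fmap (idm a) = idm (fob a);
  fmap_comp : forall a b c (v : mor b c) (u : mor a b),
    fmap (v \o u) = fmap v \o fmap u
}.
Arguments fmap {A B} _ {a a'} _.

Definition id_functor (A : Category) : Functor A A :=
  @MkFunctor A A (fun a => a) (fun _ _ u => u)
    (fun _ => eq_refl) (fun _ _ _ _ _ => eq_refl).

Lemma comp_functor_id A B C (G : Functor B C) (F : Functor A B) a :
  fmap G (fmap F (idm a)) = idm (G (F a)).
Proof. now rewrite !fmap_id. Qed.

Lemma comp_functor_comp A B C (G : Functor B C) (F : Functor A B)
    a b c (v : @mor A b c) (u : mor a b) :
  fmap G (fmap F (v \o u)) = fmap G (fmap F v) \o fmap G (fmap F u).
Proof. now rewrite !fmap_comp. Qed.

Definition comp_functor A B C (G : Functor B C) (F : Functor A B) : Functor A C :=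
  @MkFunctor A C (fun a => G (F a)) (fun _ _ u => fmap G (fmap F u))
    (comp_functor_id G F) (@comp_functor_comp A B C G F).

Definition naturally_isomorphic A B (F G : Functor A B) : Prop :=
  exists eta : forall a, mor (F a) (G a),
    (forall a b (u : mor a b), eta b \o fmap F u = fmap G u \o eta a) /\
    (forall a, is_iso (eta a)).

Definition is_equivalence A B (F : Functor A B) : Prop :=
  exists G : Functor B A,
    naturally_isomorphic (comp_functor G F) (id_functor A) /\
    naturally_isomorphic (comp_functor F G) (id_functor B).

(** The square
<<
      A --T--> B
      |        |
      L        R
      v        v
      C --K--> D
>>
    commutes strictly and has the strict universal property of a pullback. *)
Definition is_pullback A B C D (T : Functor A B) (L : Functor A C)
    (R : Functor B D) (K : Functor C D) : Prop :=
  comp_functor R T = comp_functor K L /\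
  forall (X : Category) (S : Functor X B) (U : Functor X C),
    comp_functor R S = comp_functor K U ->
    exists! V : Functor X A, comp_functor T V = S /\ comp_functor L V = U.

Section HeqTheory.
Variable A : Category.

Lemma heq_of_eq (a b : A) (u v : mor a b) : u = v -> u === v.
Proof. intros []; constructor. Qed.

Lemma heq_sym (a b a' b' : A) (u : mor a b) (v : mor a' b') : u === v -> v === u.
Proof. intros []; constructor. Qed.

Lemma heq_trans (a b a' b' a'' b'' : A)
    (u : mor a b) (v : mor a' b') (w : mor a'' b'') :
  u === v -> v === w -> u === w.
Proof. intros H []; exact H. Qed.

Lemma heq_inv (a b a' b' : A) (u : mor a b) (v : mor a' b') :
  u === v -> exists (p : a = a') (q : b = b'),
    v = match p in _ = x, q in _ = y return mor x y with
        | eq_refl, eq_refl => u end.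
Proof. intros []; exists eq_refl, eq_refl; reflexivity. Qed.

Lemma heq_eq (a b : A) (u v : mor a b) : u === v -> u = v.
Proof.
intros H; destruct (heq_inv H) as [p [q E]].
rewrite (proof_irrelevance _ p eq_refl), (proof_irrelevance _ q eq_refl) in E.
now symmetry.
Qed.

Lemma heq_comp (a b c a' b' c' : A) (v : mor b c) (u : mor a b)
    (v' : mor b' c') (u' : mor a' b') :
  v === v' -> u === u' -> v \o u === v' \o u'.
Proof.
intros H H'; destruct (heq_inv H) as [p [q E]], (heq_inv H') as [p' [q' E']].
subst a' b' c'; rewrite (proof_irrelevance _ q' eq_refl) in E'.
simpl in *; subst; constructor.
Qed.

Lemma idcast_heq (a b : A) (e : a = b) : idcast e === idm b.
Proof. destruct e; constructor. Qed.

Lemma comp_idcast (a b c : A) (e : a = b) (v : mor b c) : v \o idcast e === v.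
Proof. destruct e; simpl; rewrite comp_idr; constructor. Qed.

Lemma idcast_comp (a b c : A) (e : b = c) (u : mor a b) : idcast e \o u === u.
Proof. destruct e; simpl; rewrite comp_idl; constructor. Qed.

Lemma idcast_iso (a b : A) (e : a = b) : is_iso (idcast e).
Proof. destruct e; exists (idm a); split; apply comp_idl. Qed.

Lemma comp_iso (a b c : A) (v : mor b c) (u : mor a b) :
  is_iso v -> is_iso u -> is_iso (v \o u).
Proof.
intros [v' [Hv Hv']] [u' [Hu Hu']]; exists (u' \o v'); split.
- now rewrite comp_assoc, <- (comp_assoc u'), Hv, comp_idr.
- now rewrite comp_assoc, <- (comp_assoc v), Hu', comp_idr.
Qed.
End HeqTheory.

Lemma functor_ext A B (F G : Functor A B) :
  (forall a, F a = G a) ->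
  (forall a b (u : mor a b), fmap F u === fmap G u) -> F = G.
Proof.
destruct F as [f fm fi fc], G as [g gm gi gc]; simpl; intros H H'.
assert (E : f = g) by (now apply functional_extensionality).
subst g; clear H.
assert (E : fm = gm).
{ apply functional_extensionality_dep; intros a.
  apply functional_extensionality_dep; intros b.
  apply functional_extensionality; intros u.
  now apply heq_eq, H'. }
subst gm; f_equal; apply proof_irrelevance.
Qed.

Lemma comp_functor_idl A B (F : Functor A B) : comp_functor (id_functor B) F = F.
Proof. apply functor_ext; intros; constructor. Qed.

Lemma comp_functor_idr A B (F : Functor A B) : comp_functor F (id_functor A) = F.
Proof. apply functor_ext; intros; constructor. Qed.

(** Vertical composition is the composition of the hom-categories; the
    horizontal structure is given by composition of 1-cells and the two
    whiskerings, the horizontal composite of 2-cells being either side of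
    [interchange]. *)
Record TwoCat := MkTwoCat {
  ob :> Type;
  hom : ob -> ob -> Category;
  id1 : forall x, hom x x;
  comp1 : forall {x y z}, hom y z -> hom x y -> hom x z;
  lwhisk : forall {x y z} (g : hom y z) {f f' : hom x y},
    mor f f' -> mor (comp1 g f) (comp1 g f');
  rwhisk : forall {x y z} {g g' : hom y z},
    mor g g' -> forall f : hom x y, mor (comp1 g f) (comp1 g' f);
  comp1_idl : forall x y (f : hom x y), comp1 (id1 y) f = f;
  comp1_idr : forall x y (f : hom x y), comp1 f (id1 x) = f;
  comp1_assoc : forall x y z w (h : hom z w) (g : hom y z) (f : hom x y),
    comp1 h (comp1 g f) = comp1 (comp1 h g) f;
  lwhisk_id : forall x y z (g : hom y z) (f : hom x y),
    lwhisk g (idm f) = idm (comp1 g f);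
  lwhisk_comp : forall x y z (g : hom y z) (f f' f'' : hom x y)
      (b : mor f' f'') (a : mor f f'),
    lwhisk g (b \o a) = lwhisk g b \o lwhisk g a;
  rwhisk_id : forall x y z (g : hom y z) (f : hom x y),
    rwhisk (idm g) f = idm (comp1 g f);
  rwhisk_comp : forall x y z (g g' g'' : hom y z) (f : hom x y)
      (b : mor g' g'') (a : mor g g'),
    rwhisk (b \o a) f = rwhisk b f \o rwhisk a f;
  interchange : forall x y z (g g' : hom y z) (f f' : hom x y)
      (b : mor g g') (a : mor f f'),
    rwhisk b f' \o lwhisk g a = lwhisk g' a \o rwhisk b f;
  lwhisk_id1 : forall x y (f f' : hom x y) (a : mor f f'),
    lwhisk (id1 y) a === a;
  rwhisk_id1 : forall x y (f f' : hom x y) (a : mor f f'),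
    rwhisk a (id1 x) === a;
  lwhisk_assoc : forall x y z w (h : hom z w) (g : hom y z) (f f' : hom x y)
      (a : mor f f'),
    lwhisk h (lwhisk g a) === lwhisk (comp1 h g) a;
  lrwhisk_assoc : forall x y z w (h : hom z w) (g g' : hom y z) (a : mor g g')
      (f : hom x y),
    lwhisk h (rwhisk a f) === rwhisk (lwhisk h a) f;
  rwhisk_assoc : forall x y z w (h h' : hom z w) (a : mor h h') (g : hom y z)
      (f : hom x y),
    rwhisk a (comp1 g f) === rwhisk (rwhisk a g) f
}.
Arguments hom {_} _ _.
Arguments id1 {_} _.
Arguments comp1 {_ _ _ _} _ _.
Arguments lwhisk {_ _ _ _} _ {_ _} _.
Arguments rwhisk {_ _ _ _ _ _} _ _.

Notation "g ** f" := (comp1 g f) (at level 40, left associativity) : twocat_scope.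
Notation "g <| a" := (lwhisk g a) (at level 42, no associativity) : twocat_scope.
Notation "b |> f" := (rwhisk b f) (at level 42, no associativity) : twocat_scope.

Record TwoFunctor (C D : TwoCat) := MkTwoFunctor {
  map0 :> C -> D;
  map1 : forall {x y}, Functor (hom x y) (hom (map0 x) (map0 y));
  map1_id1 : forall x, map1 (id1 x) = id1 (map0 x);
  map1_comp1 : forall x y z (g : hom y z) (f : hom x y),
    map1 (g ** f) = map1 g ** map1 f;
  map2_lwhisk : forall x y z (g : hom y z) (f f' : hom x y) (a : mor f f'),
    fmap map1 (g <| a) === map1 g <| fmap map1 a;
  map2_rwhisk : forall x y z (g g' : hom y z) (a : mor g g') (f : hom x y),
    fmap map1 (a |> f) === fmap map1 a |> map1 f
}.
Arguments map1 {C D} _ {x y}.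

Record Marking (J : TwoCat) := MkMarking {
  marked :> forall x y : J, hom x y -> Prop;
  marked_id : forall x, marked (id1 x)
}.
Arguments marked {J} _ {x y} _.

Definition equivalent_objects (D : TwoCat) (x y : D) : Prop :=
  exists (f : hom x y) (g : hom y x),
    (exists u : mor (g ** f) (id1 x), is_iso u) /\
    (exists v : mor (f ** g) (id1 y), is_iso v).

Definition is_biequivalence (D D' : TwoCat) (P : TwoFunctor D D') : Prop :=
  (forall x y : D, is_equivalence (@map1 _ _ P x y)) /\
  (forall z : D', exists x : D, equivalent_objects (P x) z).

Definition postcomp (D : TwoCat) (a : D) {x y : D} (f : hom x y) :
    Functor (hom a x) (hom a y) :=
  @MkFunctor (hom a x) (hom a y) (fun u => f ** u) (fun _ _ r => f <| r)
    (fun u => lwhisk_id f u) (fun _ _ _ s r => lwhisk_comp f s r).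

Definition is_cartesian (D B : TwoCat) (p : TwoFunctor D B) {x y : D}
    (f : hom x y) : Prop :=
  forall a : D,
    is_pullback (postcomp a f) (@map1 _ _ p a x)
                (@map1 _ _ p a y) (postcomp (p a) (map1 p f)).

Section TwoCatTheory.
Variable D : TwoCat.

Lemma heq_lwhisk (x y z : D) (g g' : hom y z) (f1 f2 f1' f2' : hom x y)
    (a : mor f1 f2) (a' : mor f1' f2') :
  g = g' -> a === a' -> g <| a === g' <| a'.
Proof. intros [] []; constructor. Qed.

Lemma heq_rwhisk (x y z : D) (f f' : hom x y) (g1 g2 g1' g2' : hom y z)
    (a : mor g1 g2) (a' : mor g1' g2') :
  f = f' -> a === a' -> a |> f === a' |> f'.
Proof. intros [] []; constructor. Qed.

Lemma rwhisk_iso (x y z : D) (f : hom x y) (g g' : hom y z) (a : mor g g') :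
  is_iso a -> is_iso (a |> f).
Proof.
intros [b [H H']]; exists (b |> f).
now rewrite <- !rwhisk_comp, H, H', !rwhisk_id.
Qed.

Lemma postcomp_id1 (a x : D) : postcomp a (id1 x) = id_functor (hom a x).
Proof.
apply functor_ext; simpl; intros.
- apply comp1_idl.
- apply lwhisk_id1.
Qed.
End TwoCatTheory.

Lemma cartesian_id1 (D B : TwoCat) (p : TwoFunctor D B) (x : D) :
  is_cartesian p (id1 x).
Proof.
intros a; rewrite map1_id1, !postcomp_id1; split.
- now rewrite comp_functor_idl, comp_functor_idr.
- intros X S U; rewrite comp_functor_idl; intros E.
  exists S; split.
  + now rewrite comp_functor_idl.
  + intros V [<- _]; now rewrite comp_functor_idl.
Qed.

Definition cartesian_marking (D B : TwoCat) (p : TwoFunctor D B) : Marking D :=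
  @MkMarking D (fun x y f => is_cartesian p f) (fun x => cartesian_id1 p x).

Record contraction (D : TwoCat) (c : D) := MkContraction {
  ctr1 : forall x : D, hom x c;
  ctr2 : forall {x y : D} (f : hom x y), mor (ctr1 y ** f) (ctr1 x);
  ctr2_id : forall x, ctr2 (id1 x) === idm (ctr1 x);
  ctr2_comp : forall x y z (g : hom y z) (f : hom x y),
    ctr2 (g ** f) === ctr2 f \o (ctr2 g |> f);
  ctr2_nat : forall x y (f g : hom x y) (a : mor f g),
    ctr2 f = ctr2 g \o (ctr1 y <| a);
  ctr1_center : ctr1 c = id1 c;
  ctr2_ctr1 : forall x, ctr2 (ctr1 x) === idm (ctr1 x)
}.
Arguments ctr1 {D c} _ x.
Arguments ctr2 {D c} _ {x y} f.

Definition is_marked_contraction (D : TwoCat) (M : Marking D) (c : D)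
    (G : contraction c) : Prop :=
  (forall x, marked M (ctr1 G x)) /\
  (forall x y (f : hom x y), marked M f -> is_iso (ctr2 G f)).

Section Cones.
Context {J C : TwoCat} (E : Marking J) (F : TwoFunctor J C).

Record LaxCone (x : C) := MkLaxCone {
  leg : forall i : J, hom x (F i);
  leg2 : forall {i j : J} (k : hom i j), mor (map1 F k ** leg i) (leg j);
  leg2_id : forall i, leg2 (id1 i) === idm (leg i);
  leg2_comp : forall i j m (h : hom j m) (k : hom i j),
    leg2 (h ** k) === leg2 h \o (map1 F h <| leg2 k);
  leg2_nat : forall i j (k k' : hom i j) (L : mor k k'),
    leg2 k = leg2 k' \o (fmap (map1 F) L |> leg i);
  leg2_marked : forall i j (k : hom i j), marked E k -> is_iso (leg2 k)
}.
Arguments leg {x} _ i.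
Arguments leg2 {x} _ {i j} k.

Record Modification {x : C} (b a : LaxCone x) := MkModification {
  md :> forall i : J, mor (leg b i) (leg a i);
  md_nat : forall i j (k : hom i j),
    leg2 a k \o (map1 F k <| md i) = md j \o leg2 b k
}.

Lemma md_ext (x : C) (b a : LaxCone x) (m n : Modification b a) :
  (forall i, m i = n i) -> m = n.
Proof.
destruct m as [m Hm], n as [n Hn]; simpl; intros H.
assert (e : m = n) by (now apply functional_extensionality_dep).
subst n; f_equal; apply proof_irrelevance.
Qed.

Definition md_id (x : C) (a : LaxCone x) : Modification a a.
Proof.
refine (@MkModification x a a (fun i => idm (leg a i)) _).
abstract (intros; rewrite lwhisk_id, comp_idl, comp_idr; reflexivity).
Defined.

Definition md_comp (x : C) (c b a : LaxCone x)
  (n : Modification b a) (m : Modification c b) : Modification c a.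
Proof.
refine (@MkModification x c a (fun i => n i \o m i) _).
abstract (intros; rewrite lwhisk_comp, comp_assoc, md_nat, <- comp_assoc,
  md_nat, comp_assoc; reflexivity).
Defined.

Definition cones_over (x : C) : Category.
Proof.
refine (@MkCategory (LaxCone x) Modification (@md_id x) (@md_comp x) _ _ _).
- abstract (intros; apply md_ext; intros; apply comp_idl).
- abstract (intros; apply md_ext; intros; apply comp_idr).
- abstract (intros; apply md_ext; intros; apply comp_assoc).
Defined.

(** The 2-cell written [lambda_k f].  Whiskering gives it the source
    [(F k lambda_i) f]; a lax cone wants the equal 1-cell [F k (lambda_i f)]. *)
Definition restrict_leg2 (l : C) (lam : LaxCone l) (x : C) (f : hom x l)
    (i j : J) (k : hom i j) : mor (map1 F k ** (leg lam i ** f)) (leg lam j ** f) :=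
  (leg2 lam k |> f) \o idcast (comp1_assoc (map1 F k) (leg lam i) f).

Lemma restrict_leg2_heq (l : C) (lam : LaxCone l) (x : C) (f : hom x l)
    (i j : J) (k : hom i j) : restrict_leg2 lam f k === leg2 lam k |> f.
Proof. apply comp_idcast. Qed.

Definition restrict_cone (l : C) (lam : LaxCone l) (x : C) (f : hom x l) :
  LaxCone x.
Proof.
refine (@MkLaxCone x (fun i => leg lam i ** f)
          (fun i j k => restrict_leg2 lam f k) _ _ _ _).
- abstract (intros i; eapply heq_trans; [apply restrict_leg2_heq|];
    rewrite <- rwhisk_id; apply heq_rwhisk; [reflexivity|apply leg2_id]).
- abstract (intros i j m h k; eapply heq_trans; [apply restrict_leg2_heq|];
    eapply heq_trans; [apply heq_rwhisk; [reflexivity|apply leg2_comp]|];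
    rewrite rwhisk_comp; apply heq_sym, heq_comp; [apply restrict_leg2_heq|];
    eapply heq_trans; [apply heq_lwhisk; [reflexivity|apply restrict_leg2_heq]|];
    apply lrwhisk_assoc).
- abstract (intros i j k k' L; apply heq_eq;
    eapply heq_trans; [apply restrict_leg2_heq|];
    rewrite (leg2_nat lam L), rwhisk_comp; apply heq_comp;
    [apply heq_sym, restrict_leg2_heq|apply heq_sym, rwhisk_assoc]).
- abstract (intros i j k Hk; apply comp_iso;
    [now apply rwhisk_iso, leg2_marked|apply idcast_iso]).
Defined.

Definition restrict_modification (l : C) (lam : LaxCone l) (x : C)
  (f g : hom x l) (z : mor f g) :
  Modification (restrict_cone lam f) (restrict_cone lam g).
Proof.
refine (@MkModification x (restrict_cone lam f) (restrict_cone lam g)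
          (fun i => leg lam i <| z) _).
abstract (intros i j k; simpl; apply heq_eq;
  eapply heq_trans; [apply heq_comp; [apply restrict_leg2_heq|apply lwhisk_assoc]|];
  rewrite interchange; apply heq_comp; [constructor|apply heq_sym, restrict_leg2_heq]).
Defined.

Definition restrict_functor (l : C) (lam : LaxCone l) (x : C) :
  Functor (hom x l) (cones_over x).
Proof.
refine (@MkFunctor (hom x l) (cones_over x) (@restrict_cone l lam x)
          (@restrict_modification l lam x) _ _).
- abstract (intros; apply md_ext; intros; apply lwhisk_id).
- abstract (intros; apply md_ext; intros; apply lwhisk_comp).
Defined.

Definition is_bilimit (l : C) (lam : LaxCone l) : Prop :=
  forall x : C, is_equivalence (restrict_functor lam x).

Record Cone := MkCone { apex : C; cone_of :> LaxCone apex }.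

(** The 2-cells [c1_mu] go from the restriction of the target cone to the
    source cone. *)
Record Cone1 (X Y : Cone) := MkCone1 {
  c1 : hom (apex X) (apex Y);
  c1_mu : forall i : J, mor (leg Y i ** c1) (leg X i);
  c1_nat : forall i j (k : hom i j),
    leg2 X k \o (map1 F k <| c1_mu i) === c1_mu j \o (leg2 Y k |> c1)
}.

Record Cone2 (X Y : Cone) (m n : Cone1 X Y) := MkCone2 {
  c2 : mor (c1 m) (c1 n);
  c2_nat : forall i : J, c1_mu n i \o (leg Y i <| c2) = c1_mu m i
}.

Lemma cone1_ext (X Y : Cone) (m n : Cone1 X Y) :
  c1 m = c1 n -> (forall i, c1_mu m i === c1_mu n i) -> m = n.
Proof.
destruct m as [f m Hm], n as [g n Hn]; simpl; intros e H; subst g.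
assert (e : m = n).
{ apply functional_extensionality_dep; intros i; now apply heq_eq. }
subst n; f_equal; apply proof_irrelevance.
Qed.

Lemma cone2_ext (X Y : Cone) (m n : Cone1 X Y) (a b : Cone2 m n) :
  c2 a = c2 b -> a = b.
Proof.
destruct a as [a Ha], b as [b Hb]; simpl; intros e; subst b.
f_equal; apply proof_irrelevance.
Qed.

Definition cone2_id (X Y : Cone) (m : Cone1 X Y) : Cone2 m m.
Proof.
refine (@MkCone2 X Y m m (idm (c1 m)) _).
abstract (intros i; rewrite lwhisk_id; apply comp_idr).
Defined.

Definition cone2_comp (X Y : Cone) (m n p : Cone1 X Y)
  (b : Cone2 n p) (a : Cone2 m n) : Cone2 m p.
Proof.
refine (@MkCone2 X Y m p (c2 b \o c2 a) _).
abstract (intros i; rewrite lwhisk_comp, comp_assoc, !c2_nat; reflexivity).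
Defined.

Definition cone_hom (X Y : Cone) : Category.
Proof.
refine (@MkCategory (Cone1 X Y) (@Cone2 X Y) (@cone2_id X Y) (@cone2_comp X Y)
          _ _ _).
- abstract (intros; apply cone2_ext; apply comp_idl).
- abstract (intros; apply cone2_ext; apply comp_idr).
- abstract (intros; apply cone2_ext; apply comp_assoc).
Defined.

Lemma cone2_heq (X Y : Cone) (m n m' n' : cone_hom X Y)
    (a : mor m n) (a' : mor m' n') :
  m = m' -> n = n' -> c2 a === c2 a' -> a === a'.
Proof.
intros p q; revert a'; destruct p, q; intros a' H.
apply heq_of_eq, cone2_ext, heq_eq, H.
Qed.

Definition cone1_id (X : Cone) : cone_hom X X.
Proof.
refine (@MkCone1 X X (id1 (apex X)) (fun i => idcast (comp1_idr (leg X i))) _).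
abstract (intros i j k;
  eapply heq_trans; [apply heq_comp;
    [constructor|apply heq_lwhisk; [reflexivity|apply idcast_heq]]|];
  rewrite lwhisk_id, comp_idr; apply heq_sym;
  eapply heq_trans; [apply idcast_comp|apply rwhisk_id1]).
Defined.

Definition cone1_comp_mu (X Y Z : Cone) (n : Cone1 Y Z) (m : Cone1 X Y) (i : J) :
    mor (leg Z i ** (c1 n ** c1 m)) (leg X i) :=
  c1_mu m i \o (c1_mu n i |> c1 m) \o idcast (comp1_assoc (leg Z i) (c1 n) (c1 m)).

Lemma cone1_comp_mu_heq (X Y Z : Cone) (n : Cone1 Y Z) (m : Cone1 X Y) (i : J) :
  cone1_comp_mu n m i === c1_mu m i \o (c1_mu n i |> c1 m).
Proof. apply comp_idcast. Qed.

Definition cone1_comp (X Y Z : Cone) (n : cone_hom Y Z) (m : cone_hom X Y) :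
  cone_hom X Z.
Proof.
refine (@MkCone1 X Z (c1 n ** c1 m) (cone1_comp_mu n m) _).
abstract (intros i j k;
  eapply heq_trans; [apply heq_comp;
    [constructor|apply heq_lwhisk; [reflexivity|apply cone1_comp_mu_heq]]|];
  rewrite lwhisk_comp, comp_assoc;
  eapply heq_trans; [apply heq_comp; [apply c1_nat|apply lrwhisk_assoc]|];
  rewrite <- comp_assoc, <- rwhisk_comp;
  eapply heq_trans; [apply heq_comp;
    [constructor|apply heq_rwhisk; [reflexivity|apply c1_nat]]|];
  rewrite rwhisk_comp, comp_assoc;
  apply heq_sym, heq_comp; [apply cone1_comp_mu_heq|apply rwhisk_assoc]).
Defined.

Definition cone_lwhisk (X Y Z : Cone) (n : cone_hom Y Z) (m m' : cone_hom X Y)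
  (a : mor m m') : mor (cone1_comp n m) (cone1_comp n m').
Proof.
refine (@MkCone2 X Z (cone1_comp n m) (cone1_comp n m') (c1 n <| c2 a) _).
abstract (intros i; apply heq_eq; simpl;
  eapply heq_trans; [apply heq_comp; [apply cone1_comp_mu_heq|apply lwhisk_assoc]|];
  rewrite <- comp_assoc, interchange, comp_assoc, c2_nat;
  apply heq_sym, cone1_comp_mu_heq).
Defined.

Definition cone_rwhisk (X Y Z : Cone) (n n' : cone_hom Y Z) (b : mor n n')
  (m : cone_hom X Y) : mor (cone1_comp n m) (cone1_comp n' m).
Proof.
refine (@MkCone2 X Z (cone1_comp n m) (cone1_comp n' m) (c2 b |> c1 m) _).
abstract (intros i; apply heq_eq; simpl;
  eapply heq_trans; [apply heq_comp; [apply cone1_comp_mu_heq|apply lrwhisk_assoc]|];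
  rewrite <- comp_assoc, <- rwhisk_comp, c2_nat;
  apply heq_sym, cone1_comp_mu_heq).
Defined.

Lemma cone1_idl (X Y : Cone) (m : cone_hom X Y) : cone1_comp (cone1_id Y) m = m.
Proof.
apply cone1_ext; simpl; [apply comp1_idl|intros i].
eapply heq_trans; [apply (cone1_comp_mu_heq (cone1_id Y) m)|]; simpl.
eapply heq_trans; [apply heq_comp;
  [constructor|apply heq_rwhisk; [reflexivity|apply idcast_heq]]|].
rewrite rwhisk_id, comp_idr; constructor.
Qed.

Lemma cone1_idr (X Y : Cone) (m : cone_hom X Y) : cone1_comp m (cone1_id X) = m.
Proof.
apply cone1_ext; simpl; [apply comp1_idr|intros i].
eapply heq_trans; [apply (cone1_comp_mu_heq m (cone1_id X))|]; simpl.
eapply heq_trans; [apply idcast_comp|apply rwhisk_id1].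
Qed.

Lemma cone1_assoc (X Y Z W : Cone) (p : cone_hom Z W) (n : cone_hom Y Z)
    (m : cone_hom X Y) :
  cone1_comp p (cone1_comp n m) = cone1_comp (cone1_comp p n) m.
Proof.
apply cone1_ext; simpl; [apply comp1_assoc|intros i].
eapply heq_trans; [apply (cone1_comp_mu_heq p (cone1_comp n m))|]; simpl.
eapply heq_trans; [apply heq_comp; [apply cone1_comp_mu_heq|apply rwhisk_assoc]|].
rewrite <- comp_assoc, <- rwhisk_comp.
apply heq_sym.
eapply heq_trans; [apply (cone1_comp_mu_heq (cone1_comp p n) m)|]; simpl.
apply heq_comp; [constructor|].
apply heq_rwhisk; [reflexivity|apply cone1_comp_mu_heq].
Qed.

Definition TwoCat_of_cones : TwoCat.
Proof.
refine (@MkTwoCat Cone cone_hom cone1_id cone1_comp cone_lwhisk cone_rwhisk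
          cone1_idl cone1_idr cone1_assoc _ _ _ _ _ _ _ _ _ _).
- abstract (intros; apply cone2_ext; apply lwhisk_id).
- abstract (intros; apply cone2_ext; apply lwhisk_comp).
- abstract (intros; apply cone2_ext; apply rwhisk_id).
- abstract (intros; apply cone2_ext; apply rwhisk_comp).
- abstract (intros; apply cone2_ext; apply interchange).
- abstract (intros; apply cone2_heq; [apply cone1_idl..|apply lwhisk_id1]).
- abstract (intros; apply cone2_heq; [apply cone1_idr..|apply rwhisk_id1]).
- abstract (intros; apply cone2_heq; [apply cone1_assoc..|apply lwhisk_assoc]).
- abstract (intros; apply cone2_heq; [apply cone1_assoc..|apply lrwhisk_assoc]).
- abstract (intros; apply cone2_heq; [apply cone1_assoc..|apply rwhisk_assoc]).
Defined.

Definition cone_proj1 (X Y : Cone) : Functor (cone_hom X Y) (hom (apex X) (apex Y)) :=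
  @MkFunctor (cone_hom X Y) (hom (apex X) (apex Y))
    (@c1 X Y) (fun m n a => c2 a)
    (fun _ => eq_refl) (fun _ _ _ _ _ => eq_refl).

Definition cone_proj : TwoFunctor TwoCat_of_cones C :=
  @MkTwoFunctor TwoCat_of_cones C apex cone_proj1
    (fun _ => eq_refl) (fun _ _ _ _ _ => eq_refl)
    (fun _ _ _ _ _ _ _ => heq_refl _) (fun _ _ _ _ _ _ _ => heq_refl _).

Definition is_limiting_contraction (c : TwoCat_of_cones) (G : contraction c) : Prop :=
  is_marked_contraction (cartesian_marking cone_proj) G.

Definition is_limiting_bifinal (c : TwoCat_of_cones) : Prop :=
  exists G : contraction c, is_limiting_contraction G.

Section Modified.
Variables (l : C) (lam : LaxCone l).

(** [MCone], [MCone1] and [MCone2] are the cells of the modified 2-category of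
    cones over [F] with respect to [(l, lam)]: each extends the corresponding
    cell of [TwoCat_of_cones], to which [mcone_proj] projects. *)
Record MCone := MkMCone {
  mc_cone :> Cone;
  mc_h : hom (apex mc_cone) l;
  mc_sigma : forall i : J, mor (leg lam i ** mc_h) (leg mc_cone i);
  mc_sigma_iso : forall i, is_iso (mc_sigma i);
  mc_sigma_nat : forall i j (k : hom i j),
    leg2 mc_cone k \o (map1 F k <| mc_sigma i)
      === mc_sigma j \o (leg2 lam k |> mc_h)
}.

Record MCone1 (X Y : MCone) := MkMCone1 {
  m1_base : Cone1 (mc_cone X) (mc_cone Y);
  m1_zeta : mor (mc_h Y ** c1 m1_base) (mc_h X);
  m1_nat : forall i : J,
    c1_mu m1_base i \o (mc_sigma Y i |> c1 m1_base)
      === mc_sigma X i \o (leg lam i <| m1_zeta)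
}.

Record MCone2 (X Y : MCone) (m n : MCone1 X Y) := MkMCone2 {
  m2_base : Cone2 (m1_base m) (m1_base n);
  m2_nat : m1_zeta n \o (mc_h Y <| c2 m2_base) = m1_zeta m
}.

Lemma mcone1_ext (X Y : MCone) (m n : MCone1 X Y) :
  m1_base m = m1_base n -> m1_zeta m === m1_zeta n -> m = n.
Proof.
destruct m as [f m Hm], n as [g n Hn]; simpl; intros e H; subst g.
assert (e : m = n) by (now apply heq_eq).
subst n; f_equal; apply proof_irrelevance.
Qed.

Lemma mcone2_ext (X Y : MCone) (m n : MCone1 X Y) (a b : MCone2 m n) :
  m2_base a = m2_base b -> a = b.
Proof.
destruct a as [a Ha], b as [b Hb]; simpl; intros e; subst b.
f_equal; apply proof_irrelevance.
Qed.

Definition mcone2_id (X Y : MCone) (m : MCone1 X Y) : MCone2 m m.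
Proof.
refine (@MkMCone2 X Y m m (cone2_id (m1_base m)) _).
abstract (simpl; rewrite lwhisk_id; apply comp_idr).
Defined.

Definition mcone2_comp (X Y : MCone) (m n p : MCone1 X Y)
  (b : MCone2 n p) (a : MCone2 m n) : MCone2 m p.
Proof.
refine (@MkMCone2 X Y m p (cone2_comp (m2_base b) (m2_base a)) _).
abstract (simpl; rewrite lwhisk_comp, comp_assoc, <- (m2_nat a), <- (m2_nat b);
  reflexivity).
Defined.

Definition mcone_hom (X Y : MCone) : Category.
Proof.
refine (@MkCategory (MCone1 X Y) (@MCone2 X Y) (@mcone2_id X Y)
          (@mcone2_comp X Y) _ _ _).
- abstract (intros; apply mcone2_ext, cone2_ext; apply comp_idl).
- abstract (intros; apply mcone2_ext, cone2_ext; apply comp_idr).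
- abstract (intros; apply mcone2_ext, cone2_ext; apply comp_assoc).
Defined.

Lemma mcone2_heq (X Y : MCone) (m n m' n' : mcone_hom X Y)
    (a : mor m n) (a' : mor m' n') :
  m = m' -> n = n' -> c2 (m2_base a) === c2 (m2_base a') -> a === a'.
Proof.
intros p q; revert a'; destruct p, q; intros a' H.
apply heq_of_eq, mcone2_ext, cone2_ext, heq_eq, H.
Qed.

Definition mcone1_id (X : MCone) : mcone_hom X X.
Proof.
refine (@MkMCone1 X X (cone1_id (mc_cone X)) (idcast (comp1_idr (mc_h X))) _).
abstract (intros i; simpl;
  eapply heq_trans; [apply idcast_comp|];
  eapply heq_trans; [apply rwhisk_id1|]; apply heq_sym;
  eapply heq_trans; [apply heq_comp;
    [constructor|apply heq_lwhisk; [reflexivity|apply idcast_heq]]|];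
  rewrite lwhisk_id, comp_idr; constructor).
Defined.

Definition mcone1_comp_zeta (X Y Z : MCone) (n : MCone1 Y Z) (m : MCone1 X Y) :
    mor (mc_h Z ** (c1 (m1_base n) ** c1 (m1_base m))) (mc_h X) :=
  m1_zeta m \o (m1_zeta n |> c1 (m1_base m))
    \o idcast (comp1_assoc (mc_h Z) (c1 (m1_base n)) (c1 (m1_base m))).

Lemma mcone1_comp_zeta_heq (X Y Z : MCone) (n : MCone1 Y Z) (m : MCone1 X Y) :
  mcone1_comp_zeta n m === m1_zeta m \o (m1_zeta n |> c1 (m1_base m)).
Proof. apply comp_idcast. Qed.

Definition mcone1_comp (X Y Z : MCone) (n : mcone_hom Y Z) (m : mcone_hom X Y) :
  mcone_hom X Z.
Proof.
refine (@MkMCone1 X Z (cone1_comp (m1_base n) (m1_base m))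
          (mcone1_comp_zeta n m) _).
abstract (intros i; simpl;
  eapply heq_trans; [apply heq_comp; [apply cone1_comp_mu_heq|apply rwhisk_assoc]|];
  rewrite <- comp_assoc, <- rwhisk_comp;
  eapply heq_trans; [apply heq_comp;
    [constructor|apply heq_rwhisk; [reflexivity|apply m1_nat]]|];
  rewrite rwhisk_comp, comp_assoc;
  eapply heq_trans; [apply heq_comp;
    [apply m1_nat|apply heq_sym, lrwhisk_assoc]|];
  rewrite <- comp_assoc, <- lwhisk_comp;
  apply heq_comp; [constructor|apply heq_lwhisk; [reflexivity|]];
  apply heq_sym, mcone1_comp_zeta_heq).
Defined.

Definition mcone_lwhisk (X Y Z : MCone) (n : mcone_hom Y Z) (m m' : mcone_hom X Y)
  (a : mor m m') : mor (mcone1_comp n m) (mcone1_comp n m').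
Proof.
refine (@MkMCone2 X Z (mcone1_comp n m) (mcone1_comp n m')
          (cone_lwhisk (m1_base n) (m2_base a)) _).
abstract (apply heq_eq; simpl;
  eapply heq_trans; [apply heq_comp; [apply mcone1_comp_zeta_heq|apply lwhisk_assoc]|];
  rewrite <- comp_assoc, interchange, comp_assoc, m2_nat;
  apply heq_sym, mcone1_comp_zeta_heq).
Defined.

Definition mcone_rwhisk (X Y Z : MCone) (n n' : mcone_hom Y Z) (b : mor n n')
  (m : mcone_hom X Y) : mor (mcone1_comp n m) (mcone1_comp n' m).
Proof.
refine (@MkMCone2 X Z (mcone1_comp n m) (mcone1_comp n' m)
          (cone_rwhisk (m2_base b) (m1_base m)) _).
abstract (apply heq_eq; simpl;
  eapply heq_trans; [apply heq_comp; [apply mcone1_comp_zeta_heq|apply lrwhisk_assoc]|];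
  rewrite <- comp_assoc, <- rwhisk_comp, m2_nat;
  apply heq_sym, mcone1_comp_zeta_heq).
Defined.

Lemma mcone1_idl (X Y : MCone) (m : mcone_hom X Y) : mcone1_comp (mcone1_id Y) m = m.
Proof.
apply mcone1_ext; [exact (cone1_idl (m1_base m))|].
eapply heq_trans; [apply (mcone1_comp_zeta_heq (mcone1_id Y) m)|]; simpl.
eapply heq_trans; [apply heq_comp;
  [constructor|apply heq_rwhisk; [reflexivity|apply idcast_heq]]|].
rewrite rwhisk_id, comp_idr; constructor.
Qed.

Lemma mcone1_idr (X Y : MCone) (m : mcone_hom X Y) : mcone1_comp m (mcone1_id X) = m.
Proof.
apply mcone1_ext; [exact (cone1_idr (m1_base m))|].
eapply heq_trans; [apply (mcone1_comp_zeta_heq m (mcone1_id X))|]; simpl.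
eapply heq_trans; [apply idcast_comp|apply rwhisk_id1].
Qed.

Lemma mcone1_assoc (X Y Z W : MCone) (p : mcone_hom Z W) (n : mcone_hom Y Z)
    (m : mcone_hom X Y) :
  mcone1_comp p (mcone1_comp n m) = mcone1_comp (mcone1_comp p n) m.
Proof.
apply mcone1_ext; [exact (cone1_assoc (m1_base p) (m1_base n) (m1_base m))|].
eapply heq_trans; [apply (mcone1_comp_zeta_heq p (mcone1_comp n m))|]; simpl.
eapply heq_trans;
  [apply heq_comp; [apply mcone1_comp_zeta_heq|apply rwhisk_assoc]|].
rewrite <- comp_assoc, <- rwhisk_comp.
apply heq_sym.
eapply heq_trans; [apply (mcone1_comp_zeta_heq (mcone1_comp p n) m)|]; simpl.
apply heq_comp; [constructor|].
apply heq_rwhisk; [reflexivity|apply mcone1_comp_zeta_heq].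
Qed.

Definition TwoCat_of_mcones : TwoCat.
Proof.
refine (@MkTwoCat MCone mcone_hom mcone1_id mcone1_comp mcone_lwhisk mcone_rwhisk
          mcone1_idl mcone1_idr mcone1_assoc _ _ _ _ _ _ _ _ _ _).
- abstract (intros; apply mcone2_ext, cone2_ext; apply lwhisk_id).
- abstract (intros; apply mcone2_ext, cone2_ext; apply lwhisk_comp).
- abstract (intros; apply mcone2_ext, cone2_ext; apply rwhisk_id).
- abstract (intros; apply mcone2_ext, cone2_ext; apply rwhisk_comp).
- abstract (intros; apply mcone2_ext, cone2_ext; apply interchange).
- abstract (intros; apply mcone2_heq; [apply mcone1_idl..|apply lwhisk_id1]).
- abstract (intros; apply mcone2_heq; [apply mcone1_idr..|apply rwhisk_id1]).
- abstract (intros; apply mcone2_heq; [apply mcone1_assoc..|apply lwhisk_assoc]).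
- abstract (intros; apply mcone2_heq; [apply mcone1_assoc..|apply lrwhisk_assoc]).
- abstract (intros; apply mcone2_heq; [apply mcone1_assoc..|apply rwhisk_assoc]).
Defined.

Definition mcone_proj1 (X Y : MCone) :
    Functor (mcone_hom X Y) (cone_hom (mc_cone X) (mc_cone Y)) :=
  @MkFunctor (mcone_hom X Y) (cone_hom (mc_cone X) (mc_cone Y))
    (@m1_base X Y) (fun m n a => m2_base a)
    (fun _ => eq_refl) (fun _ _ _ _ _ => eq_refl).

Definition mcone_proj : TwoFunctor TwoCat_of_mcones TwoCat_of_cones :=
  @MkTwoFunctor TwoCat_of_mcones TwoCat_of_cones mc_cone mcone_proj1
    (fun _ => eq_refl) (fun _ _ _ _ _ => eq_refl)
    (fun _ _ _ _ _ _ _ => heq_refl _) (fun _ _ _ _ _ _ _ => heq_refl _).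

End Modified.

End Cones.

Arguments leg {J C E F x} _ i.
Arguments leg2 {J C E F x} _ {i j} k.
Arguments MkCone {J C E F apex} _.

(* Main.v *)
(** Let [L] be the cone [(l, lam)], and call a 1-cell of cones invertible when
    its 2-cells [mu_i] are. A lift of a cone [X] to the modified 2-category is an
    invertible 1-cell [X -> L], a lift of [f : X -> Y] between lifted cones is a
    2-cell from the composite [X -> Y -> L] to [X -> L], and a modification
    [lam h -> alpha] is a 1-cell to [L] over [h]. Hence each of the three
    statements says that every cone has an invertible 1-cell to [L] and that
    every invertible 1-cell [X -> L] is terminal in its hom-category. For the
    contractions one uses that cartesian 1-cells are the invertible ones. *)
Require Import Defs.
From Stdlib Require Import ProofIrrelevance ClassicalEpsilon.

Set Implicit Arguments.
Unset Strict Implicit.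
Unset Printing Implicit Defensive.

Local Open Scope twocat_scope.

Arguments MkCone1 {J C E F X Y} _ _ _.
Arguments MkCone2 {J C E F X Y m n} _ _.

(** * Choice, isomorphisms and terminal objects in a category *)

(** Turns existence statements in [Prop] into the data of functors, inverses and contractions. *)
Lemma dep_choice (A : Type) (B : A -> Type) (R : forall a, B a -> Prop) :
  (forall a, exists b, R a b) -> exists f : forall a, B a, forall a, R a (f a).
Proof.
intros H; exists (fun a => proj1_sig (constructive_indefinite_description _ (H a))).
intros a; apply proj2_sig.
Qed.

Section CategoryTheory.
Variable A : Category.

Lemma iso_idm (a : A) : is_iso (idm a).
Proof. exists (idm a); split; apply comp_idl. Qed.

Lemma heq_iso (a b a' b' : A) (u : mor a b) (v : mor a' b') :
  u === v -> is_iso u -> is_iso v.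
Proof. now intros []. Qed.

(** Hides a cast behind an existential, so that later arguments only see [===]. *)
Lemma heq_recast (a b a' b' : A) (u : mor a b) :
  a = a' -> b = b' -> exists v : mor a' b', v === u.
Proof. intros [] []; exists u; constructor. Qed.

Lemma idm_heq (a b : A) : a = b -> idm a === idm b.
Proof. intros []; constructor. Qed.

Lemma iso_epi (a b c : A) (u : mor a b) (v w : mor b c) :
  is_iso u -> v \o u = w \o u -> v = w.
Proof.
intros [u' [_ Hu]] e.
now rewrite <- (comp_idr v), <- (comp_idr w), <- Hu, !comp_assoc, e.
Qed.

Lemma iso_mono (a b c : A) (u : mor b c) (v w : mor a b) :
  is_iso u -> u \o v = u \o w -> v = w.
Proof.
intros [u' [Hu _]] e.
now rewrite <- (comp_idl v), <- (comp_idl w), <- Hu, <- !comp_assoc, e.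
Qed.

Lemma iso_epi_heq (a b c a' b' c' : A) (u : mor a b) (v : mor b c)
    (u' : mor a' b') (v' : mor b' c') :
  is_iso u -> u === u' -> v \o u === v' \o u' -> v === v'.
Proof.
intros Hu H H'.
destruct (heq_inv H) as [p [q _]], (heq_inv H') as [_ [r _]]; subst a' b' c'.
apply heq_eq in H, H'; subst u'; now apply heq_of_eq, (iso_epi Hu).
Qed.

Lemma sections_iso (a b : A) (u : mor a b) (v w : mor b a) :
  v \o u = idm a -> u \o w = idm b -> is_iso u.
Proof.
intros H H'; exists v; split; [exact H|].
enough (e : v = w) by now subst.
now rewrite <- (comp_idr v), <- H', comp_assoc, H, comp_idl.
Qed.

Lemma iso_of_comp_l (a b c : A) (u : mor a b) (v : mor b c) :
  is_iso u -> is_iso (v \o u) -> is_iso v.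
Proof.
intros [u' [Hu Hu']] H.
rewrite <- (comp_idr v), <- Hu', comp_assoc.
apply comp_iso; [exact H|now exists u].
Qed.

Definition is_terminal (t : A) : Prop :=
  forall a : A, exists u : mor a t, forall v : mor a t, v = u.

Lemma terminal_eq (t : A) : is_terminal t -> forall a (u v : mor a t), u = v.
Proof. intros H a u v; destruct (H a) as [w Hw]; now rewrite (Hw u), (Hw v). Qed.

(** Serves the coherence equations of a contraction, whose two sides have sources that are equal but
    not convertible. *)
Lemma terminal_heq (t : A) : is_terminal t ->
  forall a b (u : mor a t) (v : mor b t), a = b -> u === v.
Proof. intros H a b u v e; destruct e; apply heq_of_eq, (terminal_eq H). Qed.

Lemma terminal_iso (s t : A) (u : mor s t) :
  is_terminal s -> is_terminal t -> is_iso u.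
Proof.
intros Hs Ht; destruct (Hs t) as [v _].
exists v; split; [apply (terminal_eq Hs)|apply (terminal_eq Ht)].
Qed.

Lemma iso_terminal (s t : A) (u : mor s t) :
  is_iso u -> is_terminal t -> is_terminal s.
Proof.
intros Hu Ht a; destruct Hu as [v [Hv Hv']], (Ht a) as [w _].
exists (v \o w); intros w'.
apply (@iso_mono _ _ _ u); [now exists v|apply (terminal_eq Ht)].
Qed.

End CategoryTheory.

Lemma fmap_heq (A B : Category) (F : Functor A B) (a b a' b' : A)
    (u : mor a b) (v : mor a' b') :
  u === v -> fmap F u === fmap F v.
Proof. intros []; constructor. Qed.

(** * Equivalences as fully faithful, essentially surjective functors *)

Definition fully_faithful (A B : Category) (F : Functor A B) : Prop :=
  forall a a' (v : mor (F a) (F a')), exists! u : mor a a', fmap F u = v.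

Definition essentially_surjective (A B : Category) (F : Functor A B) : Prop :=
  forall b, exists (a : A) (u : mor (F a) b), is_iso u.

(** By naturality [fmap G (fmap F u)] determines [u], since the components of [eta] can be
    cancelled. *)
Lemma faithful_of_retraction (A B : Category) (F : Functor A B) (G : Functor B A) :
  naturally_isomorphic (comp_functor G F) (id_functor A) ->
  forall a a' (u v : mor a a'), fmap F u = fmap F v -> u = v.
Proof.
intros [eta [Hn Hi]] a a' u v e.
generalize (Hn _ _ u), (Hn _ _ v); simpl; rewrite e; intros -> e'.
symmetry in e'; now apply (iso_epi (Hi a)).
Qed.

Lemma equivalence_iff (A B : Category) (F : Functor A B) :
  is_equivalence F <-> fully_faithful F /\ essentially_surjective F.
Proof.
split.
- intros [G [HA HB]]; split.
  + intros a a' v.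
    assert (H : exists u : mor a a', fmap F u = v).
    { destruct HA as [eta [Hn Hi]]; simpl in *.
      destruct (Hi a) as [e' [He He']].
      (* The candidate is [fmap G v] conjugated by [eta]. Its image is [v] because [G] is itself
         faithful, having [F] as a retraction up to isomorphism. *)
      exists (eta a' \o fmap G v \o e').
      apply (faithful_of_retraction HB).
      apply (iso_mono (Hi a')).
      generalize (Hn _ _ (eta a' \o fmap G v \o e')); simpl; intros ->.
      now rewrite <- !comp_assoc, He, comp_idr. }
    destruct H as [u Hu]; exists u; split; [exact Hu|].
    intros u' Hu'; apply (faithful_of_retraction HA); congruence.
  + intros b; destruct HB as [eta [_ Hi]]; exists (G b), (eta b); apply Hi.
- intros [Hf He].
  apply dep_choice in He; destruct He as [g He].
  apply dep_choice in He; destruct He as [eps Heps].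
  (* The inverse functor acts on [v] by conjugation with [eps]. Morphisms are packed with their
     endpoints so that [dep_choice] applies with a single index. *)
  assert (H : forall p : {bb : B * B & mor (fst bb) (snd bb)},
    exists u : mor (g (fst (projT1 p))) (g (snd (projT1 p))),
      eps _ \o fmap F u = projT2 p \o eps _).
  { intros [[b b'] v]; simpl.
    destruct (Heps b') as [e [H H']].
    destruct (Hf _ _ (e \o v \o eps b)) as [u [Hu _]]; exists u.
    now rewrite Hu, !comp_assoc, H', comp_idl. }
  apply dep_choice in H; destruct H as [gm Hgm].
  set (gmap := fun b b' (v : mor b b') =>
    gm (existT (fun bb : B * B => mor (fst bb) (snd bb)) (b, b') v)
      : mor (g b) (g b')).
  assert (Hg : forall b b' (v : mor b b'), eps b' \o fmap F (gmap b b' v) = v \o eps b)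
    by (intros b b' v; exact (Hgm (existT _ (b, b') v))).
  clearbody gmap; clear gm Hgm.
  assert (faith : forall a a' (u v : mor a a'), fmap F u = fmap F v -> u = v).
  { intros a a' u v e; destruct (Hf _ _ (fmap F v)) as [w [_ Hw]].
    now rewrite <- (Hw u), <- (Hw v). }
  assert (Gi : forall b, gmap b b (idm b) = idm (g b)).
  { intros b; apply faith, (iso_mono (Heps b)).
    now rewrite Hg, fmap_id, comp_idl, comp_idr. }
  assert (Gc : forall b b' b'' (v : mor b' b'') (u : mor b b'),
    gmap _ _ (v \o u) = gmap _ _ v \o gmap _ _ u).
  { intros b b' b'' v u; apply faith, (iso_mono (Heps b'')).
    now rewrite Hg, fmap_comp, comp_assoc, Hg, <- !comp_assoc, Hg. }
  exists (@MkFunctor B A g gmap Gi Gc); split.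
  (* The unit is the preimage of [eps] under [F]; full faithfulness reflects its naturality and
     invertibility. *)
  + assert (H : forall a, exists u : mor (g (F a)) a, fmap F u = eps (F a)).
    { intros a; destruct (Hf _ _ (eps (F a))) as [u [Hu _]]; now exists u. }
    apply dep_choice in H; destruct H as [eta Heta].
    exists eta; split.
    * intros a b u; apply faith; simpl.
      now rewrite !fmap_comp, !Heta, Hg.
    * intros a; destruct (Heps (F a)) as [e [H H']].
      destruct (Hf _ _ e) as [v [Hv _]].
      exists v; simpl; split; apply faith; rewrite fmap_comp, Hv, Heta, fmap_id; assumption.
  + exists eps; split; [intros; simpl; apply Hg|exact Heps].
Qed.

(** * Strict pullbacks of categories, elementwise *)

Definition unit_category : Category :=
  @MkCategory unit (fun _ _ => unit) (fun _ => tt) (fun _ _ _ _ _ => tt)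
    (fun _ _ u => match u with tt => eq_refl end)
    (fun _ _ u => match u with tt => eq_refl end)
    (fun _ _ _ _ _ _ _ => eq_refl).

Definition constant_functor (A : Category) (a : A) : Functor unit_category A :=
  @MkFunctor unit_category A (fun _ => a) (fun _ _ _ => idm a)
    (fun _ => eq_refl) (fun _ _ _ _ _ => eq_sym (comp_idl (idm a))).

Lemma comp_constant_functor (A B : Category) (F : Functor A B) (a : A) :
  comp_functor F (constant_functor a) = constant_functor (F a).
Proof.
apply functor_ext; intros; [reflexivity|apply heq_of_eq; simpl; apply fmap_id].
Qed.

Section Pullback.
Variables (A B C D : Category) (T : Functor A B) (L : Functor A C)
  (R : Functor B D) (K : Functor C D).

(** Functors out of [unit_category] pick out objects, so the universal property is tested against
    constant functors. *)
Lemma pullback_object :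
  is_pullback T L R K ->
  forall b c, R b = K c -> exists! a, T a = b /\ L a = c.
Proof.
intros [_ H] b c e.
destruct (H unit_category (constant_functor b) (constant_functor c)) as [V [[HT HL] HV]].
{ rewrite !comp_constant_functor; now f_equal. }
exists (V tt); split; [split|].
- exact (f_equal (fun G : Functor unit_category B => G tt) HT).
- exact (f_equal (fun G : Functor unit_category C => G tt) HL).
- intros a [<- <-].
  rewrite (HV (constant_functor a)); [reflexivity|].
  now rewrite !comp_constant_functor.
Qed.

(** The mediating functor is chosen on objects and on morphisms separately. Joint injectivity of [T]
    and [L] then yields both functoriality and uniqueness. *)
Lemma pullback_intro :
  comp_functor R T = comp_functor K L ->
  (forall b c, R b = K c -> exists a, T a = b /\ L a = c) ->
  (forall a a', T a = T a' -> L a = L a' -> a = a') ->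
  (forall a a' (s : mor (T a) (T a')) (u : mor (L a) (L a')),
    fmap R s === fmap K u ->
    exists m : mor a a', fmap T m = s /\ fmap L m = u) ->
  (forall a a' (m n : mor a a'),
    fmap T m = fmap T n -> fmap L m = fmap L n -> m = n) ->
  is_pullback T L R K.
Proof.
intros HC Hob Hobu Hmor Hmoru; split; [exact HC|].
intros X S U HSU.
assert (Hs : forall x y (w : @mor X x y), fmap R (fmap S w) === fmap K (fmap U w)).
{ intros x y w; change (fmap (comp_functor R S) w === fmap (comp_functor K U) w).
  rewrite HSU; constructor. }
assert (H : forall x, exists a, T a = S x /\ L a = U x).
{ intros x; apply Hob; exact (f_equal (fun G : Functor X D => G x) HSU). }
apply dep_choice in H; destruct H as [v Hv].
assert (H : forall p : {xx : X * X & mor (fst xx) (snd xx)},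
  exists m : mor (v (fst (projT1 p))) (v (snd (projT1 p))),
    fmap T m === fmap S (projT2 p) /\ fmap L m === fmap U (projT2 p)).
{ intros [[x y] w]; simpl.
  destruct (Hv x) as [Tx Lx], (Hv y) as [Ty Ly].
  destruct (heq_recast (fmap S w) (eq_sym Tx) (eq_sym Ty)) as [s es].
  destruct (heq_recast (fmap U w) (eq_sym Lx) (eq_sym Ly)) as [u eu].
  destruct (Hmor _ _ s u) as [m [<- <-]].
  - eapply heq_trans; [apply fmap_heq, es|].
    eapply heq_trans; [apply Hs|apply heq_sym, fmap_heq, eu].
  - now exists m. }
apply dep_choice in H; destruct H as [vm Hvm].
set (vmap := fun x y (w : mor x y) =>
  vm (existT (fun xx : X * X => mor (fst xx) (snd xx)) (x, y) w)
    : mor (v x) (v y)).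
assert (HT : forall x y (w : mor x y), fmap T (vmap x y w) === fmap S w)
  by (intros x y w; exact (proj1 (Hvm (existT _ (x, y) w)))).
assert (HL : forall x y (w : mor x y), fmap L (vmap x y w) === fmap U w)
  by (intros x y w; exact (proj2 (Hvm (existT _ (x, y) w)))).
clearbody vmap; clear vm Hvm.
assert (Vi : forall x, vmap x x (idm x) = idm (v x)).
{ intros x; destruct (Hv x) as [Tx Lx]; apply Hmoru; apply heq_eq.
  - eapply heq_trans; [apply HT|]; rewrite !fmap_id; now apply idm_heq.
  - eapply heq_trans; [apply HL|]; rewrite !fmap_id; now apply idm_heq. }
assert (Vc : forall x y z (w : mor y z) (w' : mor x y),
  vmap _ _ (w \o w') = vmap _ _ w \o vmap _ _ w').
{ intros x y z w w'; apply Hmoru; apply heq_eq.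
  - eapply heq_trans; [apply HT|]; rewrite !fmap_comp.
    apply heq_sym, heq_comp; apply HT.
  - eapply heq_trans; [apply HL|]; rewrite !fmap_comp.
    apply heq_sym, heq_comp; apply HL. }
exists (@MkFunctor X A v vmap Vi Vc); split; [split|].
- apply functor_ext; [intros x; apply Hv|exact HT].
- apply functor_ext; [intros x; apply Hv|exact HL].
- intros W [WS WU].
  assert (e : forall x, v x = W x).
  { intros x; apply Hobu.
    - rewrite (proj1 (Hv x)); now rewrite <- WS.
    - rewrite (proj2 (Hv x)); now rewrite <- WU. }
  apply functor_ext; [exact e|simpl; intros x y w].
  destruct (heq_recast (vmap x y w) (e x) (e y)) as [n en].
  enough (n = fmap W w) as <- by now apply heq_sym.
  apply Hmoru; apply heq_eq.
  + eapply heq_trans; [apply fmap_heq, en|].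
    eapply heq_trans; [apply HT|]; rewrite <- WS; constructor.
  + eapply heq_trans; [apply fmap_heq, en|].
    eapply heq_trans; [apply HL|]; rewrite <- WU; constructor.
Qed.

End Pullback.

(** * Invertible 1-cells of cones are the cartesian ones *)

Section Cones.
Context {J C : TwoCat} {E : Marking J} {F : TwoFunctor J C}.
Notation Cones := (TwoCat_of_cones E F).

Definition invertible {X Y : Cone E F} (m : Cone1 X Y) : Prop :=
  forall i, is_iso (c1_mu m i).

Lemma invertible_comp (X Y Z : Cones) (n : hom Y Z) (m : hom X Y) :
  invertible n -> invertible m -> invertible (n ** m).
Proof.
intros Hn Hm i; apply comp_iso; [apply comp_iso|apply idcast_iso].
- apply Hm.
- apply rwhisk_iso, Hn.
Qed.

Lemma invertible_id (X : Cones) : invertible (id1 X).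
Proof. intros i; apply idcast_iso. Qed.

Lemma c2_iso (X Y : Cones) (m n : hom X Y) (a : mor m n) :
  is_iso a -> is_iso (c2 a).
Proof.
intros [b [H H']]; exists (c2 b); split.
- exact (f_equal (fun u : mor m m => c2 u) H).
- exact (f_equal (fun u : mor n n => c2 u) H').
Qed.

Lemma invertible_cone2 (X Y : Cones) (m n : hom X Y) (a : mor m n) :
  is_iso a -> invertible n -> invertible m.
Proof.
intros Ha Hn i; rewrite <- (c2_nat a).
apply comp_iso; [apply Hn|].
apply c2_iso in Ha; destruct Ha as [b [H H']].
exists (leg Y i <| b); now rewrite <- !lwhisk_comp, H, H', !lwhisk_id.
Qed.

Section Cartesian.
Variables (X Y : Cones) (m : hom X Y).

(** The 2-cells of the factor are forced: they are those of [n] precomposed with the inverses of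
    [c1_mu m i |> u]. *)
Lemma cone1_factor (A : Cones) (n : hom A Y) (u : hom (apex A) (apex X)) :
  invertible m -> c1 n = c1 m ** u ->
  exists v : hom A X, m ** v = n /\ c1 v = u.
Proof.
intros Hm e; destruct n as [g nu Hnu]; simpl in e; subst g.
assert (H : forall i, exists v : mor (leg X i ** u) (leg A i),
  v \o (c1_mu m i |> u) === nu i).
{ intros i; destruct (rwhisk_iso u (Hm i)) as [w [Hw _]].
  exists (nu i \o idcast (eq_sym (comp1_assoc (leg Y i) (c1 m) u)) \o w).
  rewrite <- comp_assoc, Hw, comp_idr; apply comp_idcast. }
apply dep_choice in H; destruct H as [v Hv].
assert (Hn : forall i j (k : hom i j),
  leg2 A k \o (map1 F k <| v i) === v j \o (leg2 X k |> u)).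
{ intros i j k.
  (* Compatibility of [v] is checked after precomposition with this invertible 2-cell, where it
     becomes the compatibility of [n]. *)
  assert (Hi : is_iso (map1 F k <| (c1_mu m i |> u))).
  { destruct (rwhisk_iso u (Hm i)) as [w [H H']].
    exists (map1 F k <| w); now rewrite <- !lwhisk_comp, H, H', !lwhisk_id. }
  apply (iso_epi_heq Hi (lrwhisk_assoc (map1 F k) (c1_mu m i) u)).
  rewrite <- !comp_assoc, <- lwhisk_comp, <- rwhisk_comp.
  eapply heq_trans; [apply heq_comp; [constructor|apply heq_lwhisk;
    [reflexivity|apply Hv]]|].
  eapply heq_trans; [apply Hnu|].
  apply heq_sym; eapply heq_trans; [apply heq_comp; [constructor|
    apply heq_rwhisk; [reflexivity|apply c1_nat]]|].
  rewrite rwhisk_comp, comp_assoc.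
  apply heq_comp; [apply Hv|apply heq_sym, rwhisk_assoc]. }
exists (MkCone1 u v Hn); split; [|reflexivity].
apply cone1_ext; [reflexivity|intros i].
eapply heq_trans; [apply cone1_comp_mu_heq|apply Hv].
Qed.

Lemma cone1_factor_unique (A : Cones) (v v' : hom A X) :
  invertible m -> m ** v = m ** v' -> c1 v = c1 v' -> v = v'.
Proof.
intros Hm e e1; apply cone1_ext; [exact e1|intros i].
apply (@iso_epi_heq _ _ _ _ _ _ _ (c1_mu m i |> c1 v) _ (c1_mu m i |> c1 v')).
- apply rwhisk_iso, Hm.
- apply heq_rwhisk; [exact e1|constructor].
- eapply heq_trans; [apply heq_sym, (cone1_comp_mu_heq m v i)|].
  eapply heq_trans; [|apply (cone1_comp_mu_heq m v' i)].
  change (c1_mu (m ** v) i === c1_mu (m ** v') i); rewrite e; constructor.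
Qed.

(** Only the compatibility of [u] with the cones is at stake, and it follows from that of [s] by
    cancelling the invertible [c1_mu m i |> c1 v]. *)
Lemma cone2_factor (A : Cones) (v v' : hom A X) (s : mor (m ** v) (m ** v'))
    (u : mor (c1 v) (c1 v')) :
  invertible m -> c2 s = c1 m <| u ->
  exists a : mor v v', m <| a = s /\ c2 a = u.
Proof.
intros Hm e.
assert (Hu : forall i, c1_mu v' i \o (leg X i <| u) = c1_mu v i).
{ intros i; apply (iso_epi (rwhisk_iso (c1 v) (Hm i))).
  rewrite <- comp_assoc, <- interchange, comp_assoc; apply heq_eq.
  eapply heq_trans; [|apply (cone1_comp_mu_heq m v i)].
  generalize (c2_nat s i); rewrite e; simpl; intros <-.
  apply heq_comp; [apply heq_sym, cone1_comp_mu_heq|apply heq_sym, lwhisk_assoc]. }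
exists (MkCone2 u Hu); split; [|reflexivity].
apply cone2_ext; symmetry; exact e.
Qed.

Lemma invertible_cartesian : invertible m -> is_cartesian (cone_proj E F) m.
Proof.
intros Hm A; apply pullback_intro.
- apply functor_ext; intros; constructor.
- intros n u e; exact (cone1_factor Hm e).
- intros v v' e e'; exact (cone1_factor_unique Hm e e').
- intros v v' s u e; exact (cone2_factor Hm (heq_eq e)).
- intros v v' a b _ e; now apply cone2_ext.
Qed.

(* The inverses of the [c1_mu m i] come from lifting along [m] the canonical
   1-cell to [Y] from the restriction of [Y] along [c1 m]. *)
Lemma cartesian_invertible : is_cartesian (cone_proj E F) m -> invertible m.
Proof.
intros Hm.
set (A := MkCone (restrict_cone Y (c1 m)) : Cones).
assert (Hn : forall i j (k : hom i j),
  leg2 A k \o (map1 F k <| idm (leg Y i ** c1 m))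
    === idm (leg Y j ** c1 m) \o (leg2 Y k |> c1 m)).
{ intros i j k; rewrite lwhisk_id, comp_idr, comp_idl; apply restrict_leg2_heq. }
set (n := @MkCone1 _ _ _ _ A Y (c1 m) (fun i => idm (leg Y i ** c1 m)) Hn
  : hom A Y).
assert (Hr : forall i j (k : hom i j),
  leg2 X k \o (map1 F k <| (c1_mu m i \o idcast (comp1_idr (leg Y i ** c1 m))))
    === (c1_mu m j \o idcast (comp1_idr (leg Y j ** c1 m)))
          \o (leg2 A k |> id1 (apex X))).
{ intros i j k.
  eapply heq_trans; [apply heq_comp; [constructor|apply heq_lwhisk;
    [reflexivity|apply comp_idcast]]|].
  eapply heq_trans; [apply c1_nat|]; apply heq_sym.
  apply heq_comp; [apply comp_idcast|].
  eapply heq_trans; [apply rwhisk_id1|apply restrict_leg2_heq]. }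
(* [r] carries the 2-cells of [m] itself, so that [m] factors as [n ** r]. *)
set (r := @MkCone1 _ _ _ _ X A (id1 (apex X))
  (fun i => c1_mu m i \o idcast (comp1_idr (leg Y i ** c1 m))) Hr : hom X A).
assert (Enr : n ** r = m).
{ apply cone1_ext; [apply comp1_idr|intros i].
  eapply heq_trans; [apply (cone1_comp_mu_heq n r i)|]; simpl.
  rewrite rwhisk_id, comp_idr; apply comp_idcast. }
destruct (pullback_object (Hm A) (b := n) (c := id1 (apex X))) as [v [[Ev Ev'] _]].
{ symmetry; apply comp1_idr. }
change (obj (hom A X)) in v; change (m ** v = n) in Ev; change (c1 v = id1 (apex X)) in Ev'.
(* Both sides are lifts of [m] along [m] over the identity, and such lifts are unique. *)
assert (Evr : v ** r = id1 X).
{ destruct (pullback_object (Hm X) (b := m) (c := id1 (apex X))) as [w [_ Hw]].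
  { symmetry; apply comp1_idr. }
  transitivity w; [symmetry|]; apply Hw; split.
  - change (m ** (v ** r) = m); now rewrite comp1_assoc, Ev.
  - change (c1 v ** id1 (apex X) = id1 (apex X)); now rewrite Ev', comp1_idl.
  - apply (comp1_idr m).
  - reflexivity. }
intros i.
assert (H1 : c1_mu v i \o (c1_mu m i |> c1 v) === idm (leg Y i ** c1 m)).
{ eapply heq_trans; [apply heq_sym, (cone1_comp_mu_heq m v i)|].
  change (c1_mu (m ** v) i === c1_mu n i); rewrite Ev; constructor. }
assert (H2 : c1_mu r i \o (c1_mu v i |> id1 (apex X)) === idm (leg X i)).
{ eapply heq_trans; [apply heq_sym, (cone1_comp_mu_heq v r i)|].
  change (c1_mu (v ** r) i === idm (leg X i)); rewrite Evr; apply idcast_heq. }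
(* Since [c1 v] is an identity, [c1_mu v i] can be retyped as a 2-cell backwards along [c1_mu m i];
   [H1] and [H2] make it a two-sided inverse. *)
destruct (heq_recast (c1_mu v i) (a' := leg X i) (b' := leg Y i ** c1 m)) as [w Hw].
{ rewrite Ev'; apply comp1_idr. }
{ reflexivity. }
apply (@sections_iso _ _ _ _ w w); apply heq_eq.
- eapply heq_trans; [|exact H1]; apply heq_comp; [exact Hw|].
  apply heq_sym; rewrite Ev'; apply rwhisk_id1.
- eapply heq_trans; [|exact H2]; apply heq_comp.
  + apply heq_sym, comp_idcast.
  + eapply heq_trans; [exact Hw|apply heq_sym, rwhisk_id1].
Qed.

End Cartesian.

(** * The universal property common to the three statements *)

Definition universal (L : Cones) : Prop :=
  (forall X : Cones, exists t : hom X L, invertible t) /\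
  (forall (X : Cones) (t : hom X L), invertible t -> is_terminal t).

Lemma invertible_comp_inv (X Y Z : Cones) (n : hom Y Z) (m : hom X Y) i :
  invertible (n ** m) -> is_iso (c1_mu m i \o (c1_mu n i |> c1 m)).
Proof.
intros H; apply (heq_iso (cone1_comp_mu_heq n m i)), H.
Qed.

(* The components of [f] and [g], up to whiskering, are split epic and split
   monic. *)
Lemma equivalence_invertible (X Y : Cones) (f : hom X Y) (g : hom Y X) :
  (exists u : mor (g ** f) (id1 X), is_iso u) ->
  (exists v : mor (f ** g) (id1 Y), is_iso v) ->
  invertible f.
Proof.
intros [u Hu] [v Hv] i.
destruct (invertible_comp_inv i (invertible_cone2 Hu (@invertible_id X)))
  as [a [Ha Ha']].
destruct (invertible_comp_inv i (invertible_cone2 Hv (@invertible_id Y)))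
  as [b [_ Hb]].
(* The composite of [c1_mu f i] with [c1_mu g i |> c1 f] is invertible, so it suffices to invert the
   latter. Its left inverse comes from [g ** f], its right inverse from [f ** g] whiskered with
   [c1 f]. *)
apply (@iso_of_comp_l _ _ _ _ (c1_mu g i |> c1 f)); [|now exists a].
apply (@sections_iso _ _ _ _ (a \o c1_mu f i) (((c1_mu f i |> c1 g) \o b) |> c1 f)).
- now rewrite <- comp_assoc.
- now rewrite <- rwhisk_comp, comp_assoc, Hb, rwhisk_id.
Qed.

(** * Bilimits as universal cones *)

Section Bilimit.
Variables (l : C) (lam : LaxCone E F l).
Notation L := (MkCone lam : Cones).

Lemma cone1_of_modification_nat (x : C) (h : hom x l) (a : LaxCone E F x)
    (s : Modification (restrict_cone lam h) a) i j (k : hom i j) :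
  leg2 a k \o (map1 F k <| s i) === s j \o (leg2 lam k |> h).
Proof.
rewrite md_nat; apply heq_comp; [constructor|apply restrict_leg2_heq].
Qed.

Definition cone1_of_modification (x : C) (h : hom x l) (a : LaxCone E F x)
    (s : Modification (restrict_cone lam h) a) : hom (MkCone a : Cones) L :=
  @MkCone1 J C E F (MkCone a) L h (fun i => s i) (cone1_of_modification_nat s).

Lemma modification_of_cone1_nat (X : Cones) (m : hom X L) i j (k : hom i j) :
  leg2 X k \o (map1 F k <| c1_mu m i) = c1_mu m j \o restrict_leg2 lam (c1 m) k.
Proof.
apply heq_eq; eapply heq_trans; [apply c1_nat|].
apply heq_comp; [constructor|apply heq_sym, restrict_leg2_heq].
Qed.

Definition modification_of_cone1 (X : Cones) (m : hom X L) :
    Modification (restrict_cone lam (c1 m)) X :=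
  @MkModification J C E F (apex X) (restrict_cone lam (c1 m)) X
    (fun i => c1_mu m i) (modification_of_cone1_nat m).

(** Componentwise inverses automatically form a modification: compose the required equation with the
    invertible [s j]. *)
Lemma modification_iso (x : C) (a b : cones_over E F x) (s : mor a b) :
  is_iso s <-> forall i, is_iso (s i).
Proof.
split.
- intros [t [H H']] i; exists (t i); split.
  + exact (f_equal (fun u : Modification a a => u i) H).
  + exact (f_equal (fun u : Modification b b => u i) H').
- intros H; apply dep_choice in H; destruct H as [t Ht].
  assert (Hn : forall i j (k : hom i j),
    leg2 a k \o (map1 F k <| t i) = t j \o leg2 b k).
  { intros i j k; destruct (Ht i) as [Hi Hi'], (Ht j) as [Hj Hj'].
    apply (@iso_mono _ _ _ _ (s j)); [now exists (t j)|].
    rewrite !comp_assoc, Hj', comp_idl, <- md_nat, <- comp_assoc, <- lwhisk_comp, Hi'.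
    now rewrite lwhisk_id, comp_idr. }
  exists (MkModification Hn); split; apply md_ext; intros i; apply Ht.
Qed.

(** Essential surjectivity of [restrict_functor] matches the existence of invertible 1-cells to [L],
    and full faithfulness matches their terminality. *)
Lemma bilimit_universal : is_bilimit lam <-> universal L.
Proof.
split.
- intros H; split.
  + intros X; destruct (proj1 (equivalence_iff _) (H (apex X))) as [_ He].
    destruct (He (cone_of X)) as [h [s Hs]].
    destruct X as [x a]; exists (@cone1_of_modification x h a s).
    exact (proj1 (modification_iso s) Hs).
  + intros X t Ht f.
    destruct (proj1 (equivalence_iff _) (H (apex X))) as [Hf _].
    destruct (proj2 (modification_iso (a := restrict_cone lam (c1 t)) (b := X)
      (modification_of_cone1 t)) Ht) as [w [Hw Hw']].
    (* A 2-cell from [f] to [t] is a [z] whose restriction, followed by the modification of [t], is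
       that of [f]; inverting the former leaves a single equation for the restriction of [z]. *)
    destruct (Hf (c1 f) (c1 t) (w \o (modification_of_cone1 f
       : @mor (cones_over E F (apex X)) _ _))) as [z [Hz Hz']].
    assert (Hn : forall i, c1_mu t i \o (leg lam i <| z) = c1_mu f i).
    { intros i.
      change (((modification_of_cone1 t : @mor (cones_over E F (apex X)) _ _)
        \o fmap (restrict_functor lam (apex X)) z) i = modification_of_cone1 f i).
      now rewrite Hz, comp_assoc, Hw', comp_idl. }
    exists (@MkCone2 J C E F X L f t z Hn).
    intros v; apply cone2_ext; simpl; symmetry; apply Hz'.
    apply (@iso_mono _ _ _ _ (modification_of_cone1 t
      : @mor (cones_over E F (apex X)) _ _)); [now exists w|].
    rewrite comp_assoc, Hw', comp_idl; apply md_ext; intros i.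
    exact (c2_nat v i).
- intros [He Ht] x; apply equivalence_iff; split.
  + intros f g s.
    (* The identity modification makes [g] an invertible, hence terminal, 1-cell [n] to [L]. The
       2-cells from [m] to [n] are exactly the preimages of [s]. *)
    set (X := MkCone (restrict_cone lam g) : Cones).
    set (n := @cone1_of_modification x g (restrict_cone lam g)
      (idm (restrict_cone lam g : cones_over E F x))).
    set (m := @cone1_of_modification x f (restrict_cone lam g) s).
    assert (Hn : is_terminal n) by (apply Ht; intros i; apply iso_idm).
    destruct (Hn m) as [z Hz].
    exists (c2 z); split.
    * apply md_ext; intros i.
      generalize (c2_nat z i); simpl; now rewrite comp_idl.
    * intros z' Hz'; subst s.
      assert (H : forall i, c1_mu n i \o (leg lam i <| z') = c1_mu m i)
        by (intros i; apply comp_idl).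
      now rewrite <- (Hz (@MkCone2 J C E F X L m n z' H)).
  + intros a; destruct (He (MkCone a)) as [t Hi].
    exists (c1 t), (modification_of_cone1 t); now apply modification_iso.
Qed.

(** * The modified 2-category of cones *)

Definition restriction_1cell (X : MCone lam) : hom (mc_cone X : Cones) L :=
  @MkCone1 J C E F X L (mc_h X) (@mc_sigma _ _ _ _ _ _ X) (@mc_sigma_nat _ _ _ _ _ _ X).

Definition mcone_of (X : Cones) (t : hom X L) (Ht : invertible t) : MCone lam :=
  @MkMCone J C E F l lam X (c1 t) (c1_mu t) Ht (c1_nat t).

Lemma restriction_mcone_of (X : Cones) (t : hom X L) (Ht : invertible t) :
  restriction_1cell (mcone_of Ht) = t.
Proof. now destruct t. Qed.

Lemma cone2_of_mcone1_nat (X Y : MCone lam) (m : MCone1 X Y) i :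
  mc_sigma X i \o (leg lam i <| m1_zeta m)
    = cone1_comp_mu (restriction_1cell Y) (m1_base m) i.
Proof.
apply heq_eq; eapply heq_trans; [apply heq_sym, m1_nat|].
apply heq_sym, (cone1_comp_mu_heq (restriction_1cell Y) (m1_base m)).
Qed.

Definition cone2_of_mcone1 (X Y : MCone lam) (m : MCone1 X Y) :
    mor (restriction_1cell Y ** (m1_base m : hom (X : Cones) (Y : Cones)))
        (restriction_1cell X) :=
  @MkCone2 J C E F X L (restriction_1cell Y ** (m1_base m : hom (X : Cones) (Y : Cones)))
    (restriction_1cell X) (m1_zeta m) (cone2_of_mcone1_nat m).

Lemma mcone1_of_cone2_nat (X Y : MCone lam) (f : hom (X : Cones) (Y : Cones))
    (a : mor (restriction_1cell Y ** f) (restriction_1cell X)) i :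
  c1_mu f i \o (mc_sigma Y i |> c1 f) === mc_sigma X i \o (leg lam i <| c2 a).
Proof.
eapply heq_trans; [apply heq_sym, (cone1_comp_mu_heq (restriction_1cell Y) f i)|].
apply heq_of_eq; symmetry; exact (c2_nat a i).
Qed.

Definition mcone1_of_cone2 (X Y : MCone lam) (f : hom (X : Cones) (Y : Cones))
    (a : mor (restriction_1cell Y ** f) (restriction_1cell X)) : MCone1 X Y :=
  @MkMCone1 J C E F l lam X Y f (c2 a) (mcone1_of_cone2_nat a).

(** Lifting objects up to equivalence corresponds to having invertible 1-cells to [L]. On
    hom-categories, essential surjectivity gives existence of 2-cells into them, and fullness gives
    uniqueness. *)
Lemma biequivalence_universal : is_biequivalence (mcone_proj lam) <-> universal L.
Proof.
split.
- intros [Hh Ho]; split.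
  + intros X; destruct (Ho X) as [Z [f [g [Hgf Hfg]]]].
    exists (restriction_1cell Z ** g); apply invertible_comp.
    * exact (@mc_sigma_iso _ _ _ _ _ _ Z).
    * exact (equivalence_invertible Hfg Hgf).
  + intros X t Ht f.
    set (X' := mcone_of Ht); set (L' := mcone_of (@invertible_id L)).
    destruct (proj1 (equivalence_iff _) (Hh X' L')) as [Hff He].
    assert (Ez : id1 L ** f = f) by apply comp1_idl.
    rewrite <- Ez; clear Ez.
    assert (EX : restriction_1cell X' = t) by apply restriction_mcone_of.
    rewrite <- EX; clear EX.
    (* [u] and [v] give two lifts of [f]. A lift of [idm f] to a 2-cell between them has as its
       compatibility the equation [u = v]. *)
    assert (Hu : forall u v : mor (id1 L ** f) (restriction_1cell X'), u = v).
    { intros u v; apply cone2_ext.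
      destruct (Hff (@mcone1_of_cone2 X' L' f u) (@mcone1_of_cone2 X' L' f v) (idm f))
        as [w [Hw _]].
      generalize (m2_nat w); simpl in Hw; rewrite Hw; simpl.
      now rewrite lwhisk_id, comp_idr. }
    (* Only a 1-cell isomorphic to [f] lifts, so the resulting 2-cell is transported along the
       inverse [b]. *)
    destruct (He f) as [m [a Ha]]; destruct Ha as [b [Hb Hb']].
    exists (cone2_of_mcone1 m \o (id1 L <| b)); intros v; apply Hu.
- intros [He Ht].
  assert (Htr : forall X : MCone lam, is_terminal (restriction_1cell X))
    by (intros X; apply Ht; exact (@mc_sigma_iso _ _ _ _ _ _ X)).
  split.
  + intros X Y; apply equivalence_iff; split.
    * intros m n a.
      (* Both sides underlie 2-cells into the terminal [restriction_1cell X], so every 2-cell of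
         cones lifts. *)
      assert (e : m1_zeta n \o (mc_h Y <| c2 a) = m1_zeta m).
      { apply (f_equal (@c2 _ _ _ _ X L _ _)
          (terminal_eq (Htr X) (cone2_of_mcone1 n \o (restriction_1cell Y <| a))
             (cone2_of_mcone1 m))). }
      exists (MkMCone2 e); split; [reflexivity|].
      intros b Hb; apply mcone2_ext; symmetry; exact Hb.
    * intros f; destruct (Htr X (restriction_1cell Y ** f)) as [u _].
      exists (mcone1_of_cone2 u), (idm f); apply iso_idm.
  + intros X; destruct (He X) as [t Hi].
    exists (mcone_of Hi); exists (id1 X), (id1 X).
    split; exists (idcast (comp1_idl (id1 X))); apply idcast_iso.
Qed.

End Bilimit.

(** * Limiting contractions *)

Lemma limiting_bifinal_universal (L : Cones) : is_limiting_bifinal L <-> universal L.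
Proof.
split.
- intros [G [Hc Hi]]; split.
  + intros X; exists (ctr1 G X); exact (cartesian_invertible (Hc X)).
  + intros X t Ht.
    (* Naturality of [ctr2] at [v] reads [v = ctr2 G f] up to casts, since [ctr1 G L] and
       [ctr2 G (ctr1 G X)] are identities. *)
    assert (HG : is_terminal (ctr1 G X)).
    { intros f.
      assert (e : f = ctr1 G L ** f) by (rewrite (ctr1_center G); symmetry; apply comp1_idl).
      exists (ctr2 G f \o idcast e).
      intros v; apply heq_eq; apply heq_sym.
      eapply heq_trans; [apply comp_idcast|].
      rewrite (ctr2_nat G v).
      eapply heq_trans; [apply heq_comp; [apply ctr2_ctr1|]|].
      { eapply heq_trans; [apply heq_lwhisk; [apply ctr1_center|constructor]|].
        apply lwhisk_id1. }
      rewrite comp_idl; constructor. }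
    assert (e : t = ctr1 G L ** t) by (rewrite (ctr1_center G); symmetry; apply comp1_idl).
    (* [ctr2 G t] is an isomorphism from [t] to the terminal [ctr1 G X]. *)
    apply (@iso_terminal _ _ _ (ctr2 G t \o idcast e)); [|exact HG].
    apply comp_iso; [|apply idcast_iso].
    exact (Hi _ _ t (invertible_cartesian Ht)).
- intros [He Ht].
  (* The second condition makes the chosen 1-cell at [L] the identity. *)
  assert (H : forall X : Cones, exists t : hom X L, invertible t /\
    forall p : L = X, eq_rect L (fun Z : Cones => hom Z L) (id1 L) X p = t).
  { intros X; destruct (classic (L = X)) as [p|n].
    - destruct p; exists (id1 L); split; [apply invertible_id|].
      intros p; now rewrite (proof_irrelevance _ p eq_refl).
    - destruct (He X) as [t Hi]; exists t; split; [exact Hi|contradiction]. }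
  apply dep_choice in H; destruct H as [t Hi].
  assert (Htr : forall X, is_terminal (t X)) by (intros X; apply Ht, Hi).
  assert (tL : t L = id1 L) by (symmetry; exact (proj2 (Hi L) eq_refl)).
  assert (H : forall p : {XY : Cones * Cones & hom (fst XY) (snd XY)},
    exists u : mor (t (snd (projT1 p)) ** projT2 p) (t (fst (projT1 p))), True).
  { intros [[X Y] f]; destruct (Htr X (t Y ** f)) as [u _]; now exists u. }
  apply dep_choice in H; destruct H as [u _].
  set (g := fun (X Y : Cones) (f : hom X Y) =>
    u (existT (fun XY : Cones * Cones => hom (fst XY) (snd XY)) (X, Y) f)
      : mor (t Y ** f) (t X)).
  (* Each axiom on 2-cells compares two 2-cells into some terminal [t X]. *)
  unshelve eexists (@MkContraction Cones L t g _ _ _ tL _).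
  + intros X; apply (terminal_heq (Htr X)); apply comp1_idr.
  + intros X Y Z n m; apply (terminal_heq (Htr X)); apply comp1_assoc.
  + intros X Y m n a; apply (terminal_eq (Htr X)).
  + intros X; apply (terminal_heq (Htr X)); rewrite tL; apply comp1_idl.
  + split.
    * intros X; apply invertible_cartesian, Hi.
    (* For cartesian [f] the composite [t Y ** f] is invertible, so the contraction 2-cell runs
       between terminal 1-cells. *)
    * intros X Y f Hf; apply terminal_iso; [|apply Htr].
      apply Ht, invertible_comp; [apply Hi|exact (cartesian_invertible Hf)].
Qed.

End Cones.

Theorem theorem4p10 (J : TwoCat) (E : Marking J) (C : TwoCat)
  (F : TwoFunctor J C) (l : C) (lam : LaxCone E F l) :
  (is_bilimit lam <-> is_biequivalence (mcone_proj lam)) /\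
  (is_biequivalence (mcone_proj lam) <-> is_limiting_bifinal (MkCone lam)).
Proof.
rewrite bilimit_universal, biequivalence_universal, limiting_bifinal_universal.
tauto.
Qed.
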